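(* For every integer $h\ge 0$ and every $\delta\in[0,1/2]$, \[ (1/2-\delta)\cdot 2.57143^h \;\le\; \mathrm{R}_\delta(\mathsf{3\text{-}MAJ}_h)\;\le\; 1.007\cdot 2.64944^h . \]
   Context: A deterministic decision tree on $n$ variables is a binary tree whose internal nodes are labeled by input variables $x_i$ (with outgoing edges labeled 0 and 1) and whose leaves are labeled 0 or 1; on input $x\in\{0,1\}^n$ it follows the path determined by the queried values and outputs the leaf label. Its cost on $x$ is the number of variables queried on $x$. A randomized decision tree algorithm $A$ is a probability distribution over deterministic decision trees; its error on $x$ is $\Pr_{B\sim A}[B(x)\ne f(x)]$ and its cost $\mathrm{C}(A,x)$ on $x$ is the expected number of variables queried. For $\delta\ge 0$, $\mathrm{R}_\delta(f)=\min_A\max_{x}\mathrm{C}(A,x)$, the minimum over randomized algorithms $A$ whose error is at most $\delta$ on every input. The function $\mathsf{3\text{-}MAJ}_h:\{0,1\}^{3^h}\to\{0,1\}$ is defined by: $\mathsf{3\text{-}MAJ}_0$ is the identity, and for $h>0$, writing $x=(x^{(1)},x^{(2)},x^{(3)})$ with each block of length $3^{h-1}$, $\mathsf{3\text{-}MAJ}_h(x)=\mathsf{MAJ}(\mathsf{3\text{-}MAJ}_{h-1}(x^{(1)}),\mathsf{3\text{-}MAJ}_{h-1}(x^{(2)}),\mathsf{3\text{-}MAJ}_{h-1}(x^{(3)}))$, where $\mathsf{MAJ}$ is the majority of three bits (i.e., the read-once formula on the complete ternary tree of height $h$ with majority gates). *)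

(* Defs.v *)
From HB Require Import structures.
From mathcomp Require Import all_boot all_order all_algebra.
From mathcomp Require Import all_classical all_reals all_analysis.

Set Implicit Arguments.
Unset Strict Implicit.
Unset Printing Implicit Defensive.

Import Order.TTheory GRing.Theory Num.Theory.

Local Open Scope classical_set_scope.
Local Open Scope ring_scope.

Definition input (n : nat) := {ffun 'I_n -> bool}.

(* Nothing forbids a variable from being repeated along a path. *)
Inductive dtree (n : nat) : Type :=
| Leaf of bool
| Query of 'I_n & dtree n & dtree n.

Arguments Leaf {n} _.

Section dtree_countType.
Variable n : nat.

Fixpoint gentree_of_dtree (t : dtree n) : GenTree.tree bool :=
  match t with
  | Leaf b => GenTree.Leaf b
  | Query i t0 t1 =>
      GenTree.Node i [:: gentree_of_dtree t0; gentree_of_dtree t1]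
  end.

Fixpoint dtree_of_gentree (g : GenTree.tree bool) : option (dtree n) :=
  match g with
  | GenTree.Leaf b => Some (Leaf b)
  | GenTree.Node k [:: g0; g1] =>
      match (insub k : option 'I_n), dtree_of_gentree g0,
            dtree_of_gentree g1 with
      | Some i, Some t0, Some t1 => Some (Query i t0 t1)
      | _, _, _ => None
      end
  | _ => None
  end.

Lemma gentree_of_dtreeK : pcancel gentree_of_dtree dtree_of_gentree.
Proof. by elim=> [b|i t0 IH0 t1 IH1] //=; rewrite valK IH0 IH1. Qed.

End dtree_countType.

HB.instance Definition _ (n : nat) :=
  Countable.copy (dtree n) (pcan_type (@gentree_of_dtreeK n)).

HB.instance Definition _ (n : nat) := isPointed.Build (dtree n) (Leaf false).

HB.instance Definition _ (n : nat) :=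
  @isMeasurable.Build default_measure_display (dtree n) discrete_measurable
    discrete_measurable0 discrete_measurableC discrete_measurableU.

(* In [Query i t0 t1] the edge labelled 0 leads to [t0], the edge labelled 1
   to [t1]. *)
Fixpoint eval (n : nat) (t : dtree n) (x : input n) : bool :=
  match t with
  | Leaf b => b
  | Query i t0 t1 => if x i then eval t1 x else eval t0 x
  end.

Fixpoint queried (n : nat) (t : dtree n) (x : input n) : {set 'I_n} :=
  match t with
  | Leaf _ => finset.set0
  | Query i t0 t1 => i |: (if x i then queried t1 x else queried t0 x)
  end%SET.

(* A variable queried several times is counted once, so that the cost is at
   most [n] and its expectation is finite for every distribution. *)
Definition cost (n : nat) (t : dtree n) (x : input n) : nat := #|queried t x|.

Section randomized.
Context {R : realType} {n : nat}.
Implicit Types (A : probability (dtree n) R) (f : input n -> bool).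

Definition rerror A f (x : input n) : \bar R :=
  A [set B : dtree n | eval B x != f x].

Definition rcost A (x : input n) : \bar R :=
  'E_A[fun B : dtree n => (cost B x)%:R].

(* The minimum over randomized trees is written as an infimum, with which it
   coincides; in [\bar R] an empty family would give [+oo], not a default
   finite value. *)
Definition rand_complexity (delta : R) f : \bar R :=
  ereal_inf [set \big[maxe/-oo%E]_(x : input n) rcost A x
            | A in [set A : probability (dtree n) R |
                     forall x : input n, (rerror A f x <= delta%:E)%E]].

End randomized.

Definition maj (a b c : bool) : bool := (2 <= a + b + c)%N.

Lemma block_index_subproof (h : nat) (k : 'I_3) (j : 'I_(3 ^ h)) :
  (k * 3 ^ h + j < 3 ^ h.+1)%N.
Proof.
rewrite expnS; apply: (@leq_trans (k.+1 * 3 ^ h)%N).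
  by rewrite mulSn addnC ltn_add2r.
by rewrite leq_mul2r (ltn_ord k) orbT.
Qed.

Definition block_index (h : nat) (k : 'I_3) (j : 'I_(3 ^ h)) : 'I_(3 ^ h.+1) :=
  Ordinal (block_index_subproof k j).

Definition block (h : nat) (x : input (3 ^ h.+1)) (k : 'I_3) : input (3 ^ h) :=
  [ffun j => x (block_index k j)].

Fixpoint maj3 (h : nat) : input (3 ^ h) -> bool :=
  match h with
  | 0 => fun x => x ord0
  | h'.+1 => fun x =>
      maj (maj3 (block x (inord 0))) (maj3 (block x (inord 1)))
          (maj3 (block x (inord 2)))
  end.

(* Main.v *)
From Stdlib Require Import ZArith.
From HB Require Import structures.
From mathcomp Require Import all_boot all_order all_algebra.
From mathcomp Require Import all_classical all_reals all_analysis.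
From mathcomp Require Import zify ring lra.
Require Import Defs.

(* Lower bound.  A hard family of inputs of height [h + 2] is obtained from one
   of height [h] by replacing every bit [y] by a block of nine leaves, built by
   applying twice, in random order, the substitution of [(y, 0, 1)] for [y],
   with random hard blocks of values 0 and 1 at the intermediate level.  One
   leaf [u] of the block carries [y] and the others do not depend on it, so a
   tree for height [h + 2] simulates one for height [h], which queries [y] when
   the former queries [u].  Even a tree that knows [y] makes in the block, on
   average, at least [20/3] times as many queries as it has chances to query
   [u]; this is a finite optimal stopping problem, settled by an explicit
   potential.  Hence the cost grows by a factor [20/3 > 2.57143 ^ 2] every two
   levels (and by at least [3/2] over one level), and averaging over the family
   transfers the bound to randomized trees.

   Upper bound.  The recursive algorithm first evaluates random grandchildren,
   which agree with their parents with probability at least [2/3], and uses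
   their values to decide which children to complete and in which order.  Its
   expected costs satisfy a linear recursion of growth rate [2.6494387]. *)

Set Implicit Arguments.
Unset Strict Implicit.
Unset Printing Implicit Defensive.

Import Order.TTheory GRing.Theory Num.Theory.

Delimit Scope Z_scope with BZ.

(** * Restricted trees and blocks of leaves *)

Local Open Scope ring_scope.

Section restriction.
Variables (n m : nat) (phi : 'I_n -> 'I_m + bool).

(** [phi] sends a variable to a variable of the smaller input or to a constant; a query answered by
    a constant is free. *)
Fixpoint restrict (t : dtree n) : dtree m :=
  match t with
  | Leaf b => Leaf b
  | Query i t0 t1 =>
      match phi i with
      | inl l => Query l (restrict t0) (restrict t1)
      | inr b => if b then restrict t1 else restrict t0
      end
  end.

Definition extend (z : input m) : input n :=
  [ffun i => match phi i with inl l => z l | inr b => b end].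

Lemma eval_restrict t z : eval (restrict t) z = eval t (extend z).
Proof.
elim: t => [//|i t0 IH0 t1 IH1] /=; rewrite ffunE.
by case: (phi i) => [l|[]] //=; rewrite IH0 IH1.
Qed.

Lemma queried_restrict t z l :
  (l \in queried (restrict t) z) =
  [exists i, (phi i == inl l) && (i \in queried t (extend z))].
Proof.
elim: t => [b|i t0 IH0 t1 IH1] /=.
  by rewrite inE; apply/esym/existsP => -[i]; rewrite inE andbF.
rewrite ffunE; case E: (phi i) => [l'|b] /=.
  rewrite !inE.
  have -> : (l \in (if z l' then queried (restrict t1) z
                    else queried (restrict t0) z)) =
     [exists j, (phi j == inl l) && (j \in (if z l' then queried t1 (extend z)
                                            else queried t0 (extend z)))].
    by case: (z l').
  apply/orP/existsP => [[/eqP ->|/existsP[j /andP[jl jq]]]|[j]].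
  - by exists i; rewrite E eqxx !inE eqxx.
  - by exists j; rewrite jl !inE jq orbT.
  - move=> /andP[jl]; rewrite !inE => /orP[/eqP ji|jq].
      by left; move: jl; rewrite ji E => /eqP[->].
    by right; apply/existsP; exists j; rewrite jl.
have -> : (l \in queried (if b then restrict t1 else restrict t0) z) =
   [exists j, (phi j == inl l) && (j \in (if b then queried t1 (extend z)
                                          else queried t0 (extend z)))].
  by case: b E.
apply: eq_existsb => j; rewrite !inE.
by case: (j =P i) => [->|//]; rewrite E.
Qed.

End restriction.

Lemma bottom_index_subproof h k (j : 'I_(3 ^ h)) (l : 'I_(3 ^ k)) :
  (j * 3 ^ k + l < 3 ^ (h + k))%N.
Proof.
rewrite expnD; apply: (@leq_trans (j.+1 * 3 ^ k)%N).
  by rewrite mulSn addnC ltn_add2r.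
by rewrite leq_mul2r (ltn_ord j) orbT.
Qed.

Definition bottom_index h k (j : 'I_(3 ^ h)) (l : 'I_(3 ^ k)) : 'I_(3 ^ (h + k)) :=
  Ordinal (bottom_index_subproof j l).

Definition bottom_block h k (x : input (3 ^ (h + k))) (j : 'I_(3 ^ h)) :
  input (3 ^ k) := [ffun l => x (bottom_index j l)].

(** [maj3] recurses from the root, whereas hard inputs grow at the leaves; induction on the top
    height reconciles the two. *)
Lemma maj3_bottom h k (x : input (3 ^ (h + k))) :
  maj3 x = maj3 [ffun j => maj3 (bottom_block x j)].
Proof.
elim: h x => [x|h IH x].
  rewrite /= ffunE; congr maj3; apply/ffunP => l; rewrite ffunE.
  by congr (x _); apply/val_inj.
rewrite /= -/addn.
have E c : maj3 (block (h := h + k) x c) =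
           maj3 (block [ffun j => maj3 (bottom_block x j)] c).
  rewrite IH; congr maj3; apply/ffunP => j; rewrite !ffunE.
  congr maj3; apply/ffunP => l; rewrite !ffunE.
  by congr (x _); apply/val_inj; rewrite /= expnD; ring.
by rewrite !E.
Qed.

Lemma bottom_quo_subproof h k (i : 'I_(3 ^ (h + k))) : (i %/ 3 ^ k < 3 ^ h)%N.
Proof. by rewrite ltn_divLR ?expn_gt0 // -expnD. Qed.

Lemma bottom_rem_subproof h k (i : 'I_(3 ^ (h + k))) : (i %% 3 ^ k < 3 ^ k)%N.
Proof. by rewrite ltn_pmod ?expn_gt0. Qed.

Definition bottom_coord h k (i : 'I_(3 ^ (h + k))) : 'I_(3 ^ h) * 'I_(3 ^ k) :=
  (Ordinal (bottom_quo_subproof i), Ordinal (bottom_rem_subproof i)).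

Lemma bottom_coordK h k (i : 'I_(3 ^ (h + k))) :
  bottom_index (bottom_coord i).1 (bottom_coord i).2 = i.
Proof. by apply/val_inj; rewrite /= -divn_eq. Qed.

Lemma bottom_indexK h k (j : 'I_(3 ^ h)) (l : 'I_(3 ^ k)) :
  bottom_coord (bottom_index j l) = (j, l).
Proof.
have k0 : (0 < 3 ^ k)%N by rewrite expn_gt0.
rewrite /bottom_coord; congr pair; apply/val_inj => /=.
  by rewrite divnMDl // divn_small // addn0.
by rewrite modnMDl modn_small.
Qed.

Lemma card_bottom h k (Q : {set 'I_(3 ^ (h + k))}) :
  #|Q| = (\sum_(j < 3 ^ h) #|[set l | bottom_index j l \in Q]|)%N.
Proof.
rewrite -sum1_card.
rewrite (reindex (fun p : 'I_(3 ^ h) * 'I_(3 ^ k) => bottom_index p.1 p.2)) /=.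
  rewrite -(pair_big_dep xpredT (fun j l => bottom_index j l \in Q)
             (fun _ _ => 1%N)) /=.
  by apply: eq_bigr => j _; rewrite -sum1_card; apply: eq_bigl => l; rewrite inE.
exists (@bottom_coord h k) => [[j l] _|i _] /=.
  exact: bottom_indexK.
exact: bottom_coordK.
Qed.

(** * Hard families of inputs *)

Section resampling.
Variables (J S : finType).
Implicit Types (s : {ffun J -> S}) (j : J) (t : S).

Definition update s j t : {ffun J -> S} :=
  [ffun i => if i == j then t else s i].

Lemma update_id s j t : update (update s j t) j (s j) = s.
Proof. by apply/ffunP => i; rewrite !ffunE; case: eqP => [->|]. Qed.

(** Exchanging [t] with the entry of [s] at [j] is an involution on pairs: resampling one coordinate
    preserves the uniform distribution. *)
Lemma sum_update (V : nmodType) (F : {ffun J -> S} -> V) j :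
  \sum_s \sum_t F (update s j t) = (\sum_s F s) *+ #|S|.
Proof.
rewrite (pair_bigA _ (fun s t => F (update s j t))) /=.
rewrite (reindex_inj (h := fun p : {ffun J -> S} * S =>
                             (update p.1 j p.2, p.1 j))) /=; last first.
  apply: (can_inj (g := fun p => (update p.1 j p.2, p.1 j))) => -[s t] /=.
  by rewrite update_id ffunE eqxx.
under eq_bigr do rewrite update_id.
rewrite -(pair_bigA _ (fun s t => F s)) /= -sumrMnl.
by apply: eq_bigr => s _; rewrite sumr_const.
Qed.

End resampling.

Section hard_family.
Variable R : realType.

Definition advantage n (f : input n -> bool) (B : dtree n) (x : input n) : R :=
  1 - 2 * (Defs.eval B x != f x)%:R.

(* Repetitions in [Hd] are weights.  The inequality is linear in the pair
   (cost, error probability) of [B], so it extends to randomized trees. *)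
Definition hard_family n (f : input n -> bool) (K : R) (Hd : seq (input n)) :=
  (0 < size Hd)%N /\
  forall B, K * (\sum_(x <- Hd) advantage f B x) <= \sum_(x <- Hd) (cost B x)%:R.

Definition hard h K := exists Hd, hard_family (@maj3 h) K Hd.

(** On the inputs 0 and 1 a leaf has total advantage 0, and a query costs at least 1 on each, which
    bounds the advantage. *)
Lemma hard0 : hard 0 1.
Proof.
exists [:: [ffun=> false]; [ffun=> true]]; split=> // B.
rewrite mul1r !big_cons !big_nil /advantage /= !ffunE.
case: B => [b|i t0 t1].
  by rewrite /cost /= cards0; case: b => /=; lra.
have c x : 1 <= (cost (Query i t0 t1) x)%:R :> R.
  by rewrite ler1n card_gt0; apply/set0Pn; exists i; rewrite !inE eqxx.
have b0 (b : bool) : 0 <= b%:R :> R by rewrite ler0n.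
set b1 := (_ != false); set b2 := (_ != true).
by move: (c [ffun=> false]) (c [ffun=> true]) (b0 b1) (b0 b2); lra.
Qed.

(* [s : S] is a random seed: in a block, leaf [u s] carries the encoded bit and
   the other leaves have the values [pad s]. *)
Section gadget.
Variables (k : nat) (S : finType).
Variables (u : S -> 'I_(3 ^ k)) (pad : S -> 'I_(3 ^ k) -> bool).

Definition plug s (v : bool) : input (3 ^ k) :=
  [ffun l => if l == u s then v else pad s l].

Variable beta : R.
Hypothesis S_gt0 : (0 < #|S|)%N.
Hypothesis beta_ge0 : 0 <= beta.
Hypothesis maj3_plug : forall s v, maj3 (plug s v) = v.
(** [T] is chosen after [v], so it may know the encoded bit. *)
Hypothesis gadget_ineq : forall v (T : dtree (3 ^ k)),
  beta * (\sum_s (u s \in queried T (plug s v))%:R) <=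
  \sum_s #|queried T (plug s v)|%:R.

Variable h : nat.
Let seed := {ffun 'I_(3 ^ h) -> S}.

Definition inflate (y : input (3 ^ h)) (s : seed) : input (3 ^ (h + k)) :=
  [ffun i => let: (j, l) := bottom_coord i in plug (s j) (y j) l].

Lemma inflateE y s j l : inflate y s (bottom_index j l) = plug (s j) (y j) l.
Proof. by rewrite ffunE bottom_indexK. Qed.

Lemma maj3_inflate y s : maj3 (inflate y s) = maj3 y.
Proof.
rewrite maj3_bottom; congr maj3; apply/ffunP => j; rewrite ffunE.
rewrite -[RHS](maj3_plug (s j)); congr maj3; apply/ffunP => l.
by rewrite [LHS]ffunE inflateE.
Qed.

Definition deflate (s : seed) (i : 'I_(3 ^ (h + k))) : 'I_(3 ^ h) + bool :=
  let: (j, l) := bottom_coord i in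
  if l == u (s j) then inl j else inr (pad (s j) l).

Lemma extend_deflate y s : extend (deflate s) y = inflate y s.
Proof.
apply/ffunP => i; rewrite !ffunE /deflate.
by case: bottom_coord => j l; rewrite ffunE; case: eqP.
Qed.

Lemma cost_deflate B y s :
  cost (restrict (deflate s) B) y =
  (\sum_j (bottom_index j (u (s j)) \in queried B (inflate y s)))%N.
Proof.
rewrite /cost -sum1_card big_mkcond; apply: eq_bigr => j _.
rewrite queried_restrict extend_deflate.
have -> : [exists i, (deflate s i == inl j) && (i \in queried B (inflate y s))]
   = (bottom_index j (u (s j)) \in queried B (inflate y s)).
  apply/existsP/idP => [[i /andP[]]|q]; last first.
    by exists (bottom_index j (u (s j))); rewrite /deflate bottom_indexK !eqxx.
  rewrite -{2}(bottom_coordK i) /deflate; case: bottom_coord => j' l.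
  by case: (l =P _) => // -> /eqP[->].
by case: (_ \in _).
Qed.

(* The seed of block [j] is resampled; given all the rest, [B] is a tree on that
   block only. *)
Lemma gadget_block B y j :
  beta * (\sum_(s : seed) (bottom_index j (u (s j)) \in queried B (inflate y s))%:R) <=
  \sum_(s : seed) #|[set l | bottom_index j l \in queried B (inflate y s)]|%:R.
Proof.
(* Averaging over a fresh seed at [j] reduces the claim to a fixed [s] outside block [j]; [psi] then
   freezes the other blocks. *)
rewrite -(ler_pMn2r S_gt0) -mulrnAr -!(sum_update _ j) mulr_sumr.
apply: ler_sum => s _.
pose psi (i : 'I_(3 ^ (h + k))) : 'I_(3 ^ k) + bool :=
  if (bottom_coord i).1 == j then inl (bottom_coord i).2
  else inr (inflate y s i).
have Epsi t : extend psi (plug t (y j)) = inflate y (update s j t).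
  apply/ffunP => i; rewrite -(bottom_coordK i); move: (bottom_coord i) => [j' l].
  rewrite [LHS]ffunE /psi !inflateE bottom_indexK /=.
  by rewrite [update _ _ _ j']ffunE; case: (j' =P j) => [->|].
have Eq t l : (l \in queried (restrict psi B) (plug t (y j))) =
    (bottom_index j l \in queried B (inflate y (update s j t))).
  rewrite queried_restrict Epsi; apply/existsP/idP => [[i /andP[]]|q].
    rewrite -(bottom_coordK i); move: (bottom_coord i) => [j' l'].
    by rewrite /psi bottom_indexK /=; case: (j' =P j) => // -> /eqP[->].
  by exists (bottom_index j l); rewrite /psi bottom_indexK /= !eqxx.
have := gadget_ineq (y j) (restrict psi B).
under eq_bigr do rewrite Eq.
under [X in _ <= X -> _]eq_bigr => t _.
  have -> : queried (restrict psi B) (plug t (y j)) =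
     [set l | bottom_index j l \in queried B (inflate y (update s j t))]%SET.
    by apply/finset.setP => l; rewrite inE Eq.
  over.
by under [X in _ -> _ * X <= _]eq_bigr do rewrite ffunE eqxx.
Qed.

(** For each seed the simulated tree has the same advantage and pays for the queried leaves [u]
    only; block by block, the actual cost is on average at least [beta] times that. *)
Lemma hard_step K : hard h K -> hard (h + k) (beta * K).
Proof.
move=> [Hd [Hd0 HdK]].
exists [seq inflate y s | y <- Hd, s <- enum {: seed}]; split.
  rewrite size_allpairs muln_gt0 Hd0 -cardE card_ffun expn_gt0.
  by rewrite S_gt0.
move=> B; rewrite !big_allpairs_dep /=.
under eq_bigr do rewrite big_enum /=.
under [X in _ <= X]eq_bigr do rewrite big_enum /=.
have -> : \sum_(y <- Hd) \sum_(s : seed) advantage (@maj3 (h + k)) B (inflate y s)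
   = \sum_(s : seed) \sum_(y <- Hd) advantage (@maj3 h) (restrict (deflate s) B) y.
  rewrite exchange_big /=; apply: eq_bigr => s _; apply: eq_bigr => y _.
  by rewrite /advantage maj3_inflate eval_restrict extend_deflate.
apply: (@le_trans _ _ (beta * \sum_(s : seed) \sum_(y <- Hd)
                         (cost (restrict (deflate s) B) y)%:R)).
  rewrite -mulrA ler_wpM2l // mulr_sumr; apply: ler_sum => s _; exact: HdK.
rewrite exchange_big /= mulr_sumr; apply: ler_sum => y _.
have -> : \sum_(s : seed) (cost (restrict (deflate s) B) y)%:R =
  \sum_j \sum_(s : seed) (bottom_index j (u (s j)) \in queried B (inflate y s))%:R :> R.
  rewrite exchange_big /=; apply: eq_bigr => s _.
  by rewrite cost_deflate natr_sum.
rewrite mulr_sumr.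
have -> : \sum_(s : seed) (cost B (inflate y s))%:R =
  \sum_j \sum_(s : seed) #|[set l | bottom_index j l \in queried B (inflate y s)]|%:R :> R.
  rewrite exchange_big /=; apply: eq_bigr => s _.
  by rewrite /cost card_bottom natr_sum.
by apply: ler_sum => j _; exact: gadget_block.
Qed.

End gadget.
End hard_family.

(** * The gadget with nine leaves *)

Local Close Scope ring_scope.

(* Seeds are pairs of the leaf carrying the bit and of the values of all leaves,
   with a dummy value at that leaf. *)
Definition skeleton1 : seq (nat * seq bool) :=
  [:: (0, [:: false; false; true]); (0, [:: false; true; false]);
      (1, [:: false; false; true]); (1, [:: true; false; false]);
      (2, [:: false; true; false]); (2, [:: true; false; false])]%N.

Definition hard3 (v : bool) : seq (seq bool) :=
  [:: [:: ~~ v; v; v]; [:: v; ~~ v; v]; [:: v; v; ~~ v]].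

(** Six seeds at the top node, six at the child carrying the bit and nine pairs of sibling blocks:
    324 in all. *)
Definition skeleton2 : seq (nat * seq bool) :=
  [seq let: (i, top) := a.1.1 in let: (l, blk) := a.1.2 in let: (x0, x1) := a.2 in
       ((3 * i + l)%N,
        flatten [seq if c == i then blk else if nth false top c then x1 else x0
                | c <- iota 0 3])
  | a <- [seq (p, q) | p <- [seq (s, t) | s <- skeleton1, t <- skeleton1],
                       q <- [seq (x0, x1) | x0 <- hard3 false, x1 <- hard3 true]]].

Definition instances (v : bool) : seq (nat * seq bool) :=
  [seq (s.1, set_nth false s.2 s.1 v) | s <- skeleton2].

(** One entry per leaf, [None] while it is not queried. *)
Definition knowledge := seq (option bool).

Definition fits (o : option bool) (x : seq bool) : bool :=
  if o is Some c then head false x == c else true.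

Fixpoint compatible (k : knowledge) (x : seq bool) : bool :=
  if k is o :: k' then fits o x && compatible k' (behead x) else true.

(* A triple of sibling leaves matters only through the numbers of leaves known
   to be [v] and [~~ v]; code 8 is for the impossible pairs. *)
Definition triple_code (v : bool) (o1 o2 o3 : option bool) : nat :=
  let c b := (count_mem (Some b) [:: o1; o2; o3]) in
  match c v, c (~~ v) with
  | 0, 0 => 0 | 1, 0 => 1 | 0, 1 => 2 | 2, 0 => 3
  | 1, 1 => 4 | 0, 2 => 5 | 2, 1 => 6 | 1, 2 => 7 | _, _ => 8
  end%N.

Definition code_step (b : bool) (c : nat) : nat :=
  nth 8 (if b then [:: 1; 3; 4; 8; 6; 7] else [:: 2; 4; 5; 6; 7; 8])%N c.

(* The value function, over states of knowledge about a block of value [v], of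
   the problem of minimizing the sum over the 324 seeds of
   [3 * #queries - 20 * (u queried)]; it vanishes in the initial state. *)
Definition potential_table : seq (seq (seq Z)) := (
[:: [:: [:: 0; -180; 180; -288; 108; 72; -72; 180];
      [:: -180; -144; 96; -156; 60; 36; -48; 108];
      [:: 180; 96; 180; -36; 144; 36; 72; 72];
      [:: -288; -156; -36; -96; -24; 0; -60; 36];
      [:: 108; 60; 144; -24; 120; 36; 48; 72];
      [:: 72; 36; 36; 0; 36; 0; 36; 0];
      [:: -72; -48; 72; -60; 48; 36; -24; 72];
      [:: 180; 108; 72; 36; 72; 0; 72; 0]];
   [:: [:: -180; -144; 96; -156; 60; 36; -48; 108];
      [:: -144; -48; 24; -48; 64; 16; 0; 64];
      [:: 96; 24; 84; -40; 64; 20; 20; 44];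
      [:: -156; -48; -40; -20; 0; -4; -8; 20];
      [:: 60; 64; 64; 0; 80; 20; 36; 44];
      [:: 36; 16; 20; -4; 20; 0; 20; 0];
      [:: -48; 0; 20; -8; 36; 20; 4; 44];
      [:: 108; 64; 44; 20; 44; 0; 44; 0]];
   [:: [:: 180; 96; 180; -36; 144; 36; 72; 72];
      [:: 96; 24; 84; -40; 64; 20; 20; 44];
      [:: 180; 84; 96; 4; 80; 16; 52; 28];
      [:: -36; -40; 4; -40; 0; 4; -16; 16];
      [:: 144; 64; 80; 0; 64; 16; 36; 28];
      [:: 36; 20; 16; 4; 16; 0; 16; 0];
      [:: 72; 20; 52; -16; 36; 16; 8; 28];
      [:: 72; 44; 28; 16; 28; 0; 28; 0]];
   [:: [:: -288; -156; -36; -96; -24; 0; -60; 36];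
      [:: -156; -48; -40; -20; 0; -4; -8; 20];
      [:: -36; -40; 4; -40; 0; 4; -16; 16];
      [:: -96; -20; -40; 0; -8; -8; 0; 4];
      [:: -24; 0; 0; -8; 20; 4; 4; 16];
      [:: 0; -4; 4; -8; 4; 0; 4; 0];
      [:: -60; -8; -16; 0; 4; 4; 0; 16];
      [:: 36; 20; 16; 4; 16; 0; 16; 0]];
   [:: [:: 108; 60; 144; -24; 120; 36; 48; 72];
      [:: 60; 64; 64; 0; 80; 20; 36; 44];
      [:: 144; 64; 80; 0; 64; 16; 36; 28];
      [:: -24; 0; 0; -8; 20; 4; 4; 16];
      [:: 120; 80; 64; 20; 72; 16; 44; 28];
      [:: 36; 20; 16; 4; 16; 0; 16; 0];
      [:: 48; 36; 36; 4; 44; 16; 16; 28];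
      [:: 72; 44; 28; 16; 28; 0; 28; 0]];
   [:: [:: 72; 36; 36; 0; 36; 0; 36; 0];
      [:: 36; 16; 20; -4; 20; 0; 20; 0];
      [:: 36; 20; 16; 4; 16; 0; 16; 0];
      [:: 0; -4; 4; -8; 4; 0; 4; 0];
      [:: 36; 20; 16; 4; 16; 0; 16; 0];
      [:: 0; 0; 0; 0; 0; 0; 0; 0];
      [:: 36; 20; 16; 4; 16; 0; 16; 0];
      [:: 0; 0; 0; 0; 0; 0; 0; 0]];
   [:: [:: -72; -48; 72; -60; 48; 36; -24; 72];
      [:: -48; 0; 20; -8; 36; 20; 4; 44];
      [:: 72; 20; 52; -16; 36; 16; 8; 28];
      [:: -60; -8; -16; 0; 4; 4; 0; 16];
      [:: 48; 36; 36; 4; 44; 16; 16; 28];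
      [:: 36; 20; 16; 4; 16; 0; 16; 0];
      [:: -24; 4; 8; 0; 16; 16; 0; 28];
      [:: 72; 44; 28; 16; 28; 0; 28; 0]];
   [:: [:: 180; 108; 72; 36; 72; 0; 72; 0];
      [:: 108; 64; 44; 20; 44; 0; 44; 0];
      [:: 72; 44; 28; 16; 28; 0; 28; 0];
      [:: 36; 20; 16; 4; 16; 0; 16; 0];
      [:: 72; 44; 28; 16; 28; 0; 28; 0];
      [:: 0; 0; 0; 0; 0; 0; 0; 0];
      [:: 72; 44; 28; 16; 28; 0; 28; 0];
      [:: 0; 0; 0; 0; 0; 0; 0; 0]]])%BZ.

(** Code 8, a unanimous triple, occurs in no instance; it lies outside the table and gets the
    default 0. *)
Definition potential (c1 c2 c3 : nat) : Z :=
  nth 0%BZ (nth [::] (nth [::] potential_table c1) c2) c3.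

Definition state_potential (v : bool) (k : knowledge) : Z :=
  match k with
  | [:: o0; o1; o2; o3; o4; o5; o6; o7; o8] =>
      potential (triple_code v o0 o1 o2) (triple_code v o3 o4 o5)
                (triple_code v o6 o7 o8)
  | _ => 0%BZ
  end.

Definition known (k : knowledge) (i : nat) : bool := isSome (nth None k i).

(** The potential is at most the payoff of stopping now; [us] lists the carrying leaves of the
    compatible instances. *)
Definition stop_ok (v : bool) (k : knowledge) (us : seq nat) : bool :=
  (state_potential v k + 20 * Z.of_nat (count (known k) us) <=?
   3 * (Z.of_nat (count isSome k) * Z.of_nat (size us)))%BZ.

Definition advance (o : option bool) (L : seq (nat * seq bool)) :=
  [seq (e.1, behead e.2) | e <- L & fits o e.2].

(* Enumerates the 3 ^ n ways to extend the knowledge [k], most recent leaf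
   first; [L] lists the instances compatible with [k], stripped of the leaves
   already treated. *)
Fixpoint stop_check (v : bool) (n : nat) (k : knowledge) (L : seq (nat * seq bool)) :=
  match n with
  | 0 => stop_ok v (rev k) [seq e.1 | e <- L]
  | n'.+1 => all (fun o => stop_check v n' (o :: k) (advance o L))
                 [:: None; Some false; Some true]
  end.

(** The potential is at most its sum over the two answers; codes above 5 have no leaf left to
    query. *)
Definition query_ok (c : nat) (W : nat -> Z) : bool :=
  (5 < c)%N || (W c <=? W (code_step true c) + W (code_step false c))%BZ.

Definition query_check : bool :=
  all (fun a => all (fun b => all (fun c =>
    [&& query_ok c (potential a b), query_ok c (fun c' => potential a c' b) &
        query_ok c (fun c' => potential c' a b)])
   (iota 0 9)) (iota 0 9)) (iota 0 9).


Lemma query_checkT : query_check.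
Proof. by vm_compute. Qed.

Lemma stop_checkT v : stop_check v 9 [::] (instances v).
Proof. by case: v; vm_compute. Qed.

Lemma stop_checkP v n k L : stop_check v n k L ->
  forall k', size k' = n ->
  stop_ok v (rev k ++ k') [seq e.1 | e <- L & compatible k' e.2].
Proof.
elim: n k L => [|n IH] k L /=; first by move=> ok [] //= _; rewrite cats0 filter_predT.
move=> chk [//|o k'] [sk'].
have {chk} : stop_check v n (o :: k) (advance o L).
  by case: o; [case|]; case/and4P: chk.
move=> /IH/(_ _ sk'); rewrite rev_cons cat_rcons.
rewrite /advance filter_map -filter_predI -map_comp /=.
by congr (stop_ok _ _ [seq _ | _ <- _]); apply: eq_filter => e /=; rewrite andbC.
Qed.

Lemma stop_okP v k : size k = 9 ->
  stop_ok v k [seq e.1 | e <- instances v & compatible k e.2].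
Proof. exact: (stop_checkP (stop_checkT v)). Qed.

Lemma compatible_set k x i b : (i < size k)%N -> nth None k i = None ->
  compatible (set_nth None k i (Some b)) x = compatible k x && (nth false x i == b).
Proof.
elim: k x i => [//|o k IH] x [|i] /= ik; first by move=> ->; rewrite /= nth0 andbC.
by move=> oi; rewrite (IH (behead x)) // andbA nth_behead.
Qed.

Lemma compatible_nth k x i b :
  compatible k x -> nth None k i = Some b -> nth false x i = b.
Proof.
elim: k x i => [|o k IH] x [|i] //= /andP[fo kx].
  by move=> ob; move: fo; rewrite ob /= => /eqP; rewrite nth0.
by move=> /(IH _ _ kx); rewrite nth_behead.
Qed.

Lemma triple_code_bound v o1 o2 o3 : (triple_code v o1 o2 o3 < 9)%N.
Proof. by case: v o1 o2 o3 => -[[]|] [[]|] [[]|]. Qed.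

Lemma potential_query a b c : (a < 9)%N -> (b < 9)%N -> (c < 6)%N ->
  [/\ (potential a b c <= potential a b (code_step true c) +
                          potential a b (code_step false c))%BZ,
      (potential a c b <= potential a (code_step true c) b +
                          potential a (code_step false c) b)%BZ &
      (potential c a b <= potential (code_step true c) a b +
                          potential (code_step false c) a b)%BZ].
Proof.
move=> a9 b9 c6.
have /allP/(_ a) := query_checkT; rewrite mem_iota => /(_ a9).
move=> /allP/(_ b); rewrite mem_iota => /(_ b9).
have c9 : (c < 9)%N by rewrite (ltn_trans c6).
move=> /allP/(_ c); rewrite mem_iota => /(_ c9).
rewrite /query_ok leqNgt c6 /= => /and3P[? ? ?].
by split; apply: Zle_bool_imp_le.
Qed.

Lemma triple_code_query v o1 o2 :
  [/\ (triple_code v None o1 o2 < 6)%N, (triple_code v o1 None o2 < 6)%N &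
      (triple_code v o1 o2 None < 6)%N] /\
  forall b, [/\ triple_code v (Some b) o1 o2 =
                   code_step (b == v) (triple_code v None o1 o2),
                triple_code v o1 (Some b) o2 =
                   code_step (b == v) (triple_code v o1 None o2) &
                triple_code v o1 o2 (Some b) =
                   code_step (b == v) (triple_code v o1 o2 None)].
Proof. by split; [|case]; case: v o1 o2 => -[[]|] [[]|]. Qed.

Lemma state_potential_query v k i : size k = 9 -> (i < 9)%N -> nth None k i = None ->
  (state_potential v k <= state_potential v (set_nth None k i (Some true)) +
                          state_potential v (set_nth None k i (Some false)))%BZ.
Proof.
case: k => [|o0 [|o1 [|o2 [|o3 [|o4 [|o5 [|o6 [|o7 [|o8 [|]]]]]]]]]] // _.
have B a b c := triple_code_bound v a b c.
have Q1 a b c d o o' n : (n < 6)%N -> _ := potential_query (B a b c) (B d o o') (c := n).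
case: i => [|[|[|[|[|[|[|[|[|]]]]]]]]] //= _ ->.
- have [[q _ _] E] := triple_code_query v o1 o2.
  have [-> _ _] := E true; have [-> _ _] := E false.
  have [_ _] := Q1 o3 o4 o5 o6 o7 o8 _ q.
  (* For [v = false] the two answers exchange their roles in [code_step]. *)
  by case: (v) => //=; rewrite Z.add_comm.
- have [[_ q _] E] := triple_code_query v o0 o2.
  have [_ -> _] := E true; have [_ -> _] := E false.
  have [_ _] := Q1 o3 o4 o5 o6 o7 o8 _ q.
  by case: (v) => //=; rewrite Z.add_comm.
- have [[_ _ q] E] := triple_code_query v o0 o1.
  have [_ _ ->] := E true; have [_ _ ->] := E false.
  have [_ _] := Q1 o3 o4 o5 o6 o7 o8 _ q.
  by case: (v) => //=; rewrite Z.add_comm.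
- have [[q _ _] E] := triple_code_query v o4 o5.
  have [-> _ _] := E true; have [-> _ _] := E false.
  have [_ + _] := Q1 o0 o1 o2 o6 o7 o8 _ q.
  by case: (v) => //=; rewrite Z.add_comm.
- have [[_ q _] E] := triple_code_query v o3 o5.
  have [_ -> _] := E true; have [_ -> _] := E false.
  have [_ + _] := Q1 o0 o1 o2 o6 o7 o8 _ q.
  by case: (v) => //=; rewrite Z.add_comm.
- have [[_ _ q] E] := triple_code_query v o3 o4.
  have [_ _ ->] := E true; have [_ _ ->] := E false.
  have [_ + _] := Q1 o0 o1 o2 o6 o7 o8 _ q.
  by case: (v) => //=; rewrite Z.add_comm.
- have [[q _ _] E] := triple_code_query v o7 o8.
  have [-> _ _] := E true; have [-> _ _] := E false.
  have [+ _ _] := Q1 o0 o1 o2 o3 o4 o5 _ q.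
  by case: (v) => //=; rewrite Z.add_comm.
- have [[_ q _] E] := triple_code_query v o6 o8.
  have [_ -> _] := E true; have [_ -> _] := E false.
  have [+ _ _] := Q1 o0 o1 o2 o3 o4 o5 _ q.
  by case: (v) => //=; rewrite Z.add_comm.
- have [[_ _ q] E] := triple_code_query v o6 o7.
  have [_ _ ->] := E true; have [_ _ ->] := E false.
  have [+ _ _] := Q1 o0 o1 o2 o3 o4 o5 _ q.
  by case: (v) => //=; rewrite Z.add_comm.
Qed.

(** * From the potential to decision trees on nine leaves *)

Definition input9 (x : seq bool) : input (3 ^ 2) := [ffun i : 'I_(3 ^ 2) => nth false x i].

Definition index9 (u : nat) : 'I_(3 ^ 2) := inord u.

Definition known_set (k : knowledge) : {set 'I_(3 ^ 2)} := [set i : 'I_(3 ^ 2) | known k i]%SET.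

Lemma instances_lt9 v : all (fun e => e.1 < 9)%N (instances v).
Proof. by case: v; vm_compute. Qed.

Lemma card_known_set k : size k = 9 -> #|known_set k| = count isSome k.
Proof.
move=> sk; rewrite -sum1_count (big_nth None) sk big_mkord -sum1_card.
by apply: eq_bigl => i; rewrite inE.
Qed.

Lemma known_set_set k (i : 'I_(3 ^ 2)) b :
  known_set (set_nth None k i (Some b)) = (i |: known_set k)%SET.
Proof.
apply/finset.setP => j; rewrite !inE /known nth_set_nth /=.
by rewrite -(inj_eq val_inj); case: eqP.
Qed.

Section tree_potential.
Variables (v : bool) (L : seq (nat * seq bool)).
Hypothesis L_lt9 : forall e, e \in L -> (e.1 < 9)%N.
Hypothesis L_stop : forall k, size k = 9 ->
  stop_ok v k [seq e.1 | e <- L & compatible k e.2].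

(** Induction on the tree: [L_stop] settles the leaves, and at a query the potential is at most the
    sum over both answers. *)
Lemma tree_potential (T : dtree (3 ^ 2)) k : size k = 9 ->
  (state_potential v k +
   20 * Z.of_nat (\sum_(e <- L | compatible k e.2)
                    (index9 e.1 \in known_set k :|: queried T (input9 e.2))%SET) <=
   3 * Z.of_nat (\sum_(e <- L | compatible k e.2)
                    #|known_set k :|: queried T (input9 e.2)|%SET))%BZ.
Proof.
elim: T k => [b|i T0 IH0 T1 IH1] k sk.
  have := L_stop sk; rewrite /stop_ok => /Zle_bool_imp_le.
  rewrite -Nat2Z.inj_mul.
  have -> : (count isSome k * size [seq e.1 | e <- L & compatible k e.2])%coq_nat =
     (\sum_(e <- L | compatible k e.2) #|known_set k :|: queried (Leaf b) (input9 e.2)|%SET)%N.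
    rewrite multE size_map size_filter -[count _ L]sum1_count big_distrr /=.
    by apply: eq_bigr => e _; rewrite muln1 finset.setU0 card_known_set.
  have -> // : count (known k) [seq e.1 | e <- L & compatible k e.2] =
     (\sum_(e <- L | compatible k e.2)
        (index9 e.1 \in known_set k :|: queried (Leaf b) (input9 e.2))%SET)%N.
  rewrite count_map count_filter -sum1_count [RHS]big_seq_cond [LHS]big_seq_cond.
  rewrite big_mkcond [RHS]big_mkcond; apply: eq_bigr => e _ /=.
  case eL: (e \in L) => //=; rewrite andbC finset.setU0 inE inordK ?L_lt9 //.
  by case: (compatible _ _); case: known.
(* Querying a known leaf again changes neither the knowledge nor the compatible instances; a new
   leaf splits the instances by its value. *)
case Ei: (nth None k i) => [c|].
  have queriedE (e : nat * seq bool) : compatible k e.2 ->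
      (known_set k :|: queried (Query i T0 T1) (input9 e.2))%SET =
      (known_set k :|: queried (if c then T1 else T0) (input9 e.2))%SET.
    move=> /compatible_nth/(_ Ei) xi; rewrite /= ffunE xi.
    have /finset.setUidPl ik : ([set i] \subset known_set k)%SET.
      by rewrite finset.sub1set inE /known Ei.
    by rewrite finset.setUA ik; case: (c).
  have same (F : nat * seq bool -> {set 'I_(3 ^ 2)} -> nat) :
     \sum_(e <- L | compatible k e.2)
       F e (known_set k :|: queried (Query i T0 T1) (input9 e.2))%SET =
     \sum_(e <- L | compatible k e.2)
       F e (known_set k :|: queried (if c then T1 else T0) (input9 e.2))%SET.
    by apply: eq_bigr => e ke; rewrite queriedE.
  have E1 := same (fun e A => (index9 e.1 \in A)).
  have E2 := same (fun e (A : {set _}) => #|A|).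
  rewrite [in X in (X <= _)%BZ]E1 [in X in (_ <= X)%BZ]E2.
  by case: (c); [exact: IH1|exact: IH0].
have split (F : nat * seq bool -> {set 'I_(3 ^ 2)} -> nat) :
   (\sum_(e <- L | compatible k e.2)
       F e (known_set k :|: queried (Query i T0 T1) (input9 e.2))%SET =
    \sum_(e <- L | compatible (set_nth None k i (Some true)) e.2)
       F e (known_set (set_nth None k i (Some true)) :|: queried T1 (input9 e.2))%SET +
    \sum_(e <- L | compatible (set_nth None k i (Some false)) e.2)
       F e (known_set (set_nth None k i (Some false)) :|: queried T0 (input9 e.2))%SET)%N.
  have ik : (i < size k)%N by rewrite sk; exact: (ltn_ord i).
  rewrite (bigID (fun e => nth false e.2 i)) /=; congr addn; apply: eq_big => e.
  - by rewrite compatible_set // eqb_id.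
  - move=> /andP[_ xi]; rewrite ffunE xi known_set_set.
    by rewrite finset.setUCA finset.setUA.
  - by rewrite compatible_set // eqbF_neg.
  - move=> /andP[_ /negbTE xi]; rewrite ffunE xi known_set_set.
    by rewrite finset.setUCA finset.setUA.
have E1 := split (fun e A => (index9 e.1 \in A)).
have E2 := split (fun e (A : {set _}) => #|A|).
rewrite [in X in (X <= _)%BZ]E1 [in X in (_ <= X)%BZ]E2 !Nat2Z.inj_add.
cbv beta.
have sk' b : size (set_nth None k i (Some b)) = 9.
  by rewrite size_set_nth sk; apply/maxn_idPr; exact: (ltn_ord i).
have := @state_potential_query v _ _ sk (ltn_ord i) Ei.
have := IH1 _ (sk' true); have := IH0 _ (sk' false).
clear; lia.
Qed.
End tree_potential.

Local Open Scope ring_scope.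

Lemma maj3_1 (x : input (3 ^ 1)) :
  maj3 x = maj (x (inord 0 : 'I_3)) (x (inord 1 : 'I_3)) (x (inord 2 : 'I_3)).
Proof.
by rewrite /= !ffunE; congr maj; congr (x _); apply/val_inj;
  rewrite /= !inordK ?muln1 ?addn0.
Qed.

Definition maj9 (x : seq bool) : bool :=
  let m i := maj (nth false x i) (nth false x i.+1) (nth false x i.+2) in
  maj (m 0) (m 3) (m 6).

Lemma maj3_input9 x : maj3 (input9 x) = maj9 x.
Proof.
by rewrite /= /maj9; congr maj; congr maj; rewrite !ffunE /= !inordK.
Qed.

(** * Growth factors of the gadgets of heights one and two *)

Section gadgets.
Variable R : realType.

(** The leaf cyclically after [u] holds 1 and the third holds 0; the first query hits [u] for one
    seed out of three. *)
Lemma hard_step1 h (K : R) : hard h K -> hard (h + 1) (3 / 2 * K).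
Proof.
pose next (l : 'I_(3 ^ 1)) : 'I_(3 ^ 1) := inord (l.+1 %% 3).
apply: (hard_step (S := 'I_(3 ^ 1)) (u := id) (pad := fun s l => l == next s)).
- by rewrite card_ord.
- lra.
- move=> s v; rewrite maj3_1 !ffunE -!(inj_eq val_inj) /=.
  by case: s => [[|[|[|]]]] //= i; case: v; rewrite !inordK.
- move=> v T; rewrite mulr_sumr.
  case: T => [b|i T0 T1].
    by apply: ler_sum => s _ /=; rewrite inE cards0 mulr0.
  pose Q s := queried (Query i T0 T1) (plug id (fun s l => l == next s) s v).
  have iQ s : i \in Q s by rewrite /Q /= !inE eqxx.
  have c1 s : 1 <= #|Q s|%:R :> R by rewrite (ler_nat _ 1); apply/card_gt0P; exists i.
  (* If [u] is queried but not first, there are at least two queries. *)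
  have key s : 6 * (s \in Q s)%:R + 1 - 3 * (s == i)%:R <= 4 * #|Q s|%:R :> R.
    case: eqP => [->|/eqP si]; first by move: (c1 i); rewrite iQ /=; lra.
    case sQ: (s \in Q s); last by move: (c1 s); rewrite /=; lra.
    have : (1 < #|Q s|)%N by apply/card_gt1P; exists s, i; split.
    by rewrite -(ler_nat R) /=; lra.
  rewrite -mulr_sumr -[X in _ * X <= _]/(\sum_s (s \in Q s)%:R).
  rewrite -[X in _ <= X]/(\sum_s #|Q s|%:R).
  have : \sum_s (6 * (s \in Q s)%:R + 1 - 3 * (s == i)%:R) <= \sum_s 4 * #|Q s|%:R :> R.
    by apply: ler_sum => s _; exact: key.
  (* The corrections cancel: 1 for each of three seeds against 3 for the seed [i]. *)
  rewrite sumrB big_split /= sumr_const card_ord -!mulr_sumr.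
  have -> : \sum_s (s == i)%:R = 1 :> R.
    by rewrite (bigD1 i) //= eqxx big1 ?addr0 // => s /negbTE ->.
  lra.
Qed.

Definition skeleton_nth (s : 'I_(size skeleton2)) := nth (0%N, [::]) skeleton2 s.

Lemma skeleton_wf : all (fun s => (s.1 < 9)%N &&
  (maj9 (set_nth false s.2 s.1 true) && ~~ maj9 (set_nth false s.2 s.1 false)))
  skeleton2.
Proof. by vm_compute. Qed.

Lemma hard_step2 h (K : R) : hard h K -> hard (h + 2) (20 / 3 * K).
Proof.
pose u s := index9 (skeleton_nth s).1.
pose pad s (l : 'I_(3 ^ 2)) := nth false (skeleton_nth s).2 l.
have wf s : ((skeleton_nth s).1 < 9)%N /\ forall v,
    maj9 (set_nth false (skeleton_nth s).2 (skeleton_nth s).1 v) = v.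
  have /allP/(_ (skeleton_nth s)) := skeleton_wf.
  rewrite mem_nth // => /(_ isT) /andP[? /andP[mt mf]]; split=> // -[] //.
  exact/negbTE.
have plugE s v : plug u pad s v =
    input9 (set_nth false (skeleton_nth s).2 (skeleton_nth s).1 v).
  apply/ffunP => l; rewrite !ffunE nth_set_nth /= /u -(inj_eq val_inj) /=.
  by have [? _] := wf s; rewrite inordK.
apply: (hard_step (S := 'I_(size skeleton2)) (u := u) (pad := pad)).
- by rewrite card_ord.
- lra.
- by move=> s v; rewrite plugE maj3_input9; have [_ ->] := wf s.
move=> v T.
have lt9 e : e \in instances v -> (e.1 < 9)%N by move/(allP (instances_lt9 v)).
have := @tree_potential v _ lt9 (@stop_okP v) T (nseq 9 None) erefl.
have k0 : known_set (nseq 9 None) = finset.set0.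
  by apply/finset.setP => i; rewrite !inE /known nth_nseq; case: ifP.
rewrite k0.
have sumE (F : nat * seq bool -> nat) :
   (\sum_(e <- instances v | compatible (nseq 9 None) e.2) F e =
    \sum_(s < size skeleton2)
      F ((skeleton_nth s).1, set_nth false (skeleton_nth s).2 (skeleton_nth s).1 v))%N.
  rewrite /instances big_map (big_nth (0%N, [::])) big_mkord.
  by apply: eq_bigl => s; rewrite /=.
(* The initial potential 0 leaves exactly the gadget inequality with ratio 20/3. *)
have -> : state_potential v (nseq 9 None) = 0%BZ by case: (v).
rewrite !sumE Z.add_0_l.
rewrite [X in (20 * Z.of_nat X <= _)%BZ](_ : _ =
   (\sum_s (u s \in queried T (plug u pad s v)))%N); last first.
  by apply: eq_bigr => s _; rewrite finset.set0U plugE.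
rewrite [X in (_ <= 3 * Z.of_nat X)%BZ](_ : _ =
   (\sum_s #|queried T (plug u pad s v)|)%N); last first.
  by apply: eq_bigr => s _; rewrite finset.set0U plugE.
rewrite -!natr_sum.
set a := (\sum_s _)%N; set b := (\sum_s _)%N => ab.
have : (20 * a <= 3 * b)%N by lia.
rewrite -(ler_nat R) !natrM; lra.
Qed.

(** Two levels gain 20/3, which is at least [b ^+ 2]; an odd height starts with one factor 3/2, and
    the factor 2 on the right absorbs this loss. *)
Lemma hard_bound h : exists2 K : R, hard h K &
  (2 + 571 / 10 ^+ 3 + 43 / 10 ^+ 5) ^+ h <= 2 * K.
Proof.
set b := _ + _.
have b2 : b ^+ 2 <= 20 / 3 by rewrite /b expr2; lra.
have b0 : 0 <= b by rewrite /b; lra.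
rewrite -(odd_double_half h); move: (odd h) (h./2) => o.
elim=> [|n [K hK IH]].
  case: o => /=; rewrite ?add0n ?addn0.
    exists (3 / 2 * 1); first exact: (@hard_step1 0 1 (hard0 R)).
    by rewrite expr1 /b; lra.
  by exists 1; [exact: hard0|rewrite expr0; lra].
exists (20 / 3 * K).
  by rewrite doubleS -addn2 addnA; exact: hard_step2.
rewrite doubleS -addn2 addnA exprD.
apply: (le_trans (ler_wpM2l _ b2)); first exact: exprn_ge0.
by move: IH; lra.
Qed.

End gadgets.

(** * From hard families to randomized trees *)

Section discrete.
Local Open Scope classical_set_scope.
Local Open Scope ring_scope.
Variables (R : realType) (n : nat).
Implicit Types (A : probability (dtree n) R) (F : dtree n -> R).

Lemma rcostE A x : rcost A x = (\int[A]_B (cost B x)%:R%:E)%E.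
Proof. by rewrite /rcost unlock. Qed.

Lemma rerrorE A f x : rerror A f x = (\int[A]_B (Defs.eval B x != f x)%:R%:E)%E.
Proof.
rewrite /rerror -[in LHS](setIT [set B | _]) -integral_indic //.
apply: eq_integral => B _; rewrite indicE; congr (nat_of_bool _)%:R%:E.
by apply/idP/idP; rewrite in_setE.
Qed.

(** The hardness inequality is integrated over [A] and summed over [Hd]; some input must then cost
    at least the average. *)
Lemma yao A f K Hd (delta : R) : hard_family f K Hd -> 0 <= K ->
  (forall x, (rerror A f x <= delta%:E)%E) ->
  ((K * (1 - 2 * delta))%:E <= \big[maxe/-oo%E]_x rcost A x)%E.
Proof.
move=> [Hd0 HdK] K0 err.
set M := \big[_/_]_x _.
have cM x : (rcost A x <= M)%E by exact: le_bigmax.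
(* Moving the error to the cost side makes every integrand nonnegative. *)
pose G (B : dtree n) x : R := (cost B x)%:R + 2 * K * (Defs.eval B x != f x)%:R.
have G0 B x : (0 <= (G B x)%:E)%E.
  by rewrite lee_fin addr_ge0 ?mulr_ge0.
have GE x : (\int[A]_B (G B x)%:E = rcost A x + (2 * K)%:E * rerror A f x)%E.
  rewrite rcostE rerrorE -ge0_integralZl_EFin ?mulr_ge0 //.
  transitivity (\int[A]_B ((cost B x)%:R%:E +
                 (2 * K)%:E * (Defs.eval B x != f x)%:R%:E))%E.
    by apply: eq_integral => B _; rewrite /G EFinD EFinM.
  by apply: ge0_integralD => // B _; rewrite -?EFinM lee_fin ?mulr_ge0.
have low : ((K * (size Hd)%:R)%:E <= \sum_(x <- Hd) \int[A]_B (G B x)%:E)%E.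
  rewrite -ge0_integral_sum //.
  rewrite -[leLHS]mule1 -(probability_setT A) -integral_cst //.
  apply: ge0_le_integral => //.
    by move=> B _; rewrite lee_fin mulr_ge0.
  move=> B _; rewrite /cst sumEFin lee_fin.
  have := HdK B; rewrite /advantage sumrB big_split /= -!mulr_sumr.
  by rewrite big_const_seq count_predT iter_addr_0; lra.
have up : (\sum_(x <- Hd) \int[A]_B (G B x)%:E <=
           \sum_(x <- Hd) (M + (2 * K * delta)%:E))%E.
  apply: lee_sum => x _; rewrite GE leeD // (EFinM (2 * K)) lee_wpmul2l //.
  by rewrite lee_fin mulr_ge0.
have := le_trans low up.
have sz : 0 < (size Hd)%:R :> R by rewrite ltr0n.
case: M {cM GE up} => [m| |].
- rewrite -EFinD sumEFin !lee_fin big_const_seq count_predT iter_addr_0.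
  rewrite -[leRHS]mulr_natr ler_pM2r //; lra.
- by rewrite leey.
(* The value [-oo] is excluded since [Hd] is not empty. *)
rewrite addNye big_const_seq count_predT.
case: Hd Hd0 {HdK low sz} => [//|x Hd] _ /=.
by rewrite addNye leeNy_eq.
Qed.

End discrete.

(** * Randomized trees as measures *)

Inductive rtree (n : nat) : Type :=
| RLeaf of bool
| RQuery of 'I_n & rtree n & rtree n
| RMix2 of rtree n & rtree n
| RMix3 of rtree n & rtree n & rtree n.

Arguments RLeaf {n} _.

Section mixture.
Local Open Scope classical_set_scope.
Local Open Scope ring_scope.
Variables (R : realType) (n : nat).
Implicit Types (t : rtree n) (x : input n).

Fixpoint expected_cost t x : R :=
  match t with
  | RLeaf _ => 0
  | RQuery i t0 t1 => 1 + if x i then expected_cost t1 x else expected_cost t0 x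
  | RMix2 t0 t1 => (expected_cost t0 x + expected_cost t1 x) / 2
  | RMix3 t0 t1 t2 =>
      (expected_cost t0 x + expected_cost t1 x + expected_cost t2 x) / 3
  end.

(** The output is [b] whatever the random choices: the algorithm makes no error. *)
Fixpoint outputs t x b : bool :=
  match t with
  | RLeaf c => c == b
  | RQuery i t0 t1 => if x i then outputs t1 x b else outputs t0 x b
  | RMix2 t0 t1 => outputs t0 x b && outputs t1 x b
  | RMix3 t0 t1 t2 => [&& outputs t0 x b, outputs t1 x b & outputs t2 x b]
  end.

Definition scale (c : R) (L : seq (R * dtree n)) :=
  [seq (c * p.1, p.2) | p <- L].

(** Below a query the two subtrees are drawn independently; an input meets only one of them. *)
Fixpoint mixture t : seq (R * dtree n) :=
  match t with
  | RLeaf b => [:: (1, Leaf b)]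
  | RQuery i t0 t1 =>
      [seq (p.1 * q.1, Query i p.2 q.2) | p <- mixture t0, q <- mixture t1]
  | RMix2 t0 t1 => scale (1 / 2) (mixture t0 ++ mixture t1)
  | RMix3 t0 t1 t2 => scale (1 / 3) (mixture t0 ++ mixture t1 ++ mixture t2)
  end.

Definition mean (F : dtree n -> R) (L : seq (R * dtree n)) : R :=
  \sum_(p <- L) p.1 * F p.2.

Lemma mean_scale F c L : mean F (scale c L) = c * mean F L.
Proof.
by rewrite /mean big_map mulr_sumr; apply: eq_bigr => p _; rewrite mulrA.
Qed.

Lemma mean_cat F L1 L2 : mean F (L1 ++ L2) = mean F L1 + mean F L2.
Proof. exact: big_cat. Qed.

Lemma mean_query F L0 L1 i :
  mean F [seq (p.1 * q.1, Query i p.2 q.2) | p <- L0, q <- L1] =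
  mean (fun B0 => mean (fun B1 => F (Query i B0 B1)) L1) L0.
Proof.
rewrite /mean big_allpairs_dep; apply: eq_bigr => p _.
by rewrite mulr_sumr; apply: eq_bigr => q _; rewrite mulrA.
Qed.

Lemma mean_cst c L : mean (fun=> c) L = c * mean (fun=> 1) L.
Proof. by rewrite /mean mulr_sumr; apply: eq_bigr => p _; rewrite mulr1 mulrC. Qed.

Lemma mean1_mixture t : mean (fun=> 1) (mixture t) = 1.
Proof.
elim: t => [b|i t0 IH0 t1 IH1|t0 IH0 t1 IH1|t0 IH0 t1 IH1 t2 IH2] /=.
- by rewrite /mean big_seq1 mulr1.
- by rewrite mean_query IH1.
- by rewrite mean_scale mean_cat IH0 IH1; lra.
- by rewrite mean_scale !mean_cat IH0 IH1 IH2; lra.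
Qed.

Lemma mixture_ge0 t : all (fun p => 0 <= p.1) (mixture t).
Proof.
elim: t => [b|i t0 IH0 t1 IH1|t0 IH0 t1 IH1|t0 IH0 t1 IH1 t2 IH2] /=.
- by rewrite ler01.
- apply/allP => _ /allpairsP[[p q] [/= pt qt ->]] /=.
  by rewrite mulr_ge0 // ?(allP IH0 _ pt) // (allP IH1 _ qt).
- rewrite all_map; apply/allP => p /= pt; rewrite mulr_ge0 ?divr_ge0 //.
  by move: p pt; apply/allP; rewrite all_cat IH0.
- rewrite all_map; apply/allP => p /= pt; rewrite mulr_ge0 ?divr_ge0 //.
  by move: p pt; apply/allP; rewrite !all_cat IH0 IH1.
Qed.

Lemma le_mean F G L : all (fun p => 0 <= p.1) L -> (forall B, F B <= G B) ->
  mean F L <= mean G L.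
Proof.
move=> /allP L0 FG; rewrite /mean !big_seq; apply: ler_sum => p pL.
by rewrite ler_wpM2l // L0.
Qed.

Lemma cost_query i (B0 B1 : dtree n) x :
  (cost (Query i B0 B1) x <= 1 + if x i then cost B1 x else cost B0 x)%N.
Proof. by rewrite /cost /= cardsU1; case: (x i); rewrite leq_add2r leq_b1. Qed.

(** An inequality only, because [expected_cost] counts repeated queries and [cost] does not. *)
Lemma mean_cost t x : mean (fun B => (cost B x)%:R) (mixture t) <= expected_cost t x.
Proof.
elim: t => [b|i t0 IH0 t1 IH1|t0 IH0 t1 IH1|t0 IH0 t1 IH1 t2 IH2] /=.
- by rewrite /mean big_seq1 /cost cards0 mulr0.
- rewrite mean_query.
  apply: (@le_trans _ _ (mean (fun B0 => mean (fun B1 =>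
            1 + if x i then (cost B1 x)%:R else (cost B0 x)%:R) (mixture t1)) (mixture t0))).
    apply: le_mean => [|B0]; first exact: mixture_ge0.
    apply: le_mean => [|B1]; first exact: mixture_ge0.
    by case: (x i) (cost_query i B0 B1 x) => q; rewrite nat1r ler_nat.
  have meanD F c t : mean (fun B => c + F B) (mixture t) = c + mean F (mixture t).
    rewrite -[in RHS](mulr1 c) -(mean1_mixture t) -mean_cst -big_split /=.
    by apply: eq_bigr => p _; rewrite mulrDr.
  case: (x i).
    by under [X in mean X _]eq_fun do rewrite meanD; rewrite meanD mean_cst mean1_mixture mulr1 lerD2l.
  under [X in mean X _]eq_fun do rewrite meanD mean_cst mean1_mixture mulr1.
  by rewrite meanD lerD2l.
- by rewrite mean_scale mean_cat; lra.
- by rewrite mean_scale !mean_cat; lra.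
Qed.

Lemma outputs_mixture t x b : outputs t x b ->
  all (fun p => Defs.eval p.2 x == b) (mixture t).
Proof.
elim: t => [c|i t0 IH0 t1 IH1|t0 IH0 t1 IH1|t0 IH0 t1 IH1 t2 IH2] /=.
- by rewrite andbT.
- move=> tb; apply/allP => _ /allpairsP[[p q] [/= pt qt ->]] /=.
  move: tb; case: (x i); first by move/IH1/allP/(_ _ qt).
  by move/IH0/allP/(_ _ pt).
- by move=> /andP[/IH0 t0b /IH1 t1b]; rewrite all_map all_cat t0b.
- by move=> /and3P[/IH0 t0b /IH1 t1b /IH2 t2b]; rewrite all_map !all_cat t0b t1b.
Qed.

(** The absolute value supplies the nonnegative scalar of [mscale]; the weights of a mixture are
    nonnegative anyway. *)
Definition weighted_dirac (p : R * dtree n) : {measure set (dtree n) -> \bar R} :=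
  mscale (`|p.1|%:nng) (\d_(p.2)).

Definition law t : set (dtree n) -> \bar R :=
  msum (fun i => weighted_dirac (nth (0, Leaf false) (mixture t) i)) (size (mixture t)).

HB.instance Definition _ t := Measure.on (law t).

Lemma integral_law t (F : dtree n -> R) : (forall B, 0 <= F B) ->
  (\int[law t]_B (F B)%:E = (mean F (mixture t))%:E)%E.
Proof.
move=> F0; rewrite ge0_integral_measure_sum //; last by move=> B _; rewrite lee_fin.
rewrite /mean (big_nth (0, Leaf false)) big_mkord -sumEFin; apply: eq_bigr => i _.
rewrite ge0_integral_mscale //; last by move=> B _; rewrite lee_fin.
rewrite integral_dirac // diracT mul1e /= EFinM ger0_norm //.
by have /all_nthP := mixture_ge0 t; apply.
Qed.

Lemma law_setT t : law t setT = 1%E.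
Proof.
have := integral_law t (F := fun=> 1) (fun=> ler01); rewrite mean1_mixture => <-.
by rewrite (integral_cst (law t) measurableT 1%E) mul1e.
Qed.

HB.instance Definition _ t := Measure_isProbability.Build _ _ _ (law t) (law_setT t).

Lemma rcost_law t x : (rcost (law t) x <= (expected_cost t x)%:E)%E.
Proof. by rewrite rcostE integral_law // lee_fin mean_cost. Qed.

Lemma rerror_law t f x : outputs t x (f x) -> rerror (law t) f x = 0%E.
Proof.
move=> tf; rewrite rerrorE integral_law // /mean big_seq big1 // => p pt.
by have /allP/(_ p pt)/eqP -> := outputs_mixture tf; rewrite eqxx mulr0.
Qed.

End mixture.

(** * The algorithm *)

Local Notation i0 := (inord 0 : 'I_3).
Local Notation i1 := (inord 1 : 'I_3).
Local Notation i2 := (inord 2 : 'I_3).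

Definition next3 (p : 'I_3) : 'I_3 := inord (p.+1 %% 3).

Lemma next3_0 : next3 i0 = i1.
Proof. by apply/val_inj; rewrite /= !inordK. Qed.

Lemma next3_1 : next3 i1 = i2.
Proof. by apply/val_inj; rewrite /= !inordK. Qed.

Lemma next3_2 : next3 i2 = i0.
Proof. by apply/val_inj; rewrite /= !inordK. Qed.

Lemma ord3P (P : 'I_3 -> Prop) : P i0 -> P i1 -> P i2 -> forall p, P p.
Proof.
move=> P0 P1 P2 [[|[|[|//]]] i].
- by rewrite (_ : Ordinal i = i0) //; apply/val_inj; rewrite /= inordK.
- by rewrite (_ : Ordinal i = i1) //; apply/val_inj; rewrite /= inordK.
- by rewrite (_ : Ordinal i = i2) //; apply/val_inj; rewrite /= inordK.
Qed.

Section strategies.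
Variables (n : nat) (R : realType) (x : input n).
Local Notation cont := (bool -> rtree n).
Local Notation ecost t := (expected_cost R t x).

(* [E] is in continuation-passing style: it computes [v] at expected cost at
   most [c] and hands it over to [k]. *)
Definition runs (E : cont -> rtree n) (c : R) (v : bool) : Prop := forall k,
  ecost (E k) <= c + ecost (k v) /\
  forall b, outputs (k v) x b -> outputs (E k) x b.

Lemma runs_le E c c' v : runs E c v -> c <= c' -> runs E c' v.
Proof. by move=> H cc' k; have [Hc Ho] := H k; split=> //; lra. Qed.

(** Executes the first evaluation of a strategy, paying [c] out of the budget [s]. *)
Lemma runs_bind E c v k s X (O : bool -> Prop) : runs E c v ->
  ecost (k v) <= (s - c) + X /\ (forall b, O b -> outputs (k v) x b) ->
  ecost (E k) <= s + X /\ (forall b, O b -> outputs (E k) x b).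
Proof.
move=> H [kc ko]; have [Hc Ho] := H k; split=> [|b Ob]; first lra.
exact/Ho/ko.
Qed.

Definition mix3 (t : 'I_3 -> rtree n) := RMix3 (t i0) (t i1) (t i2).

Definition mix_others (p : 'I_3) (t : 'I_3 -> 'I_3 -> rtree n) :=
  RMix2 (t (next3 p) (next3 (next3 p))) (t (next3 (next3 p)) (next3 p)).

Definition mean3 (F : 'I_3 -> R) : R := (F i0 + F i1 + F i2) / 3.

Definition mean_others (p : 'I_3) (F : 'I_3 -> 'I_3 -> R) : R :=
  (F (next3 p) (next3 (next3 p)) + F (next3 (next3 p)) (next3 p)) / 2.

Lemma runs_mix3 (E : 'I_3 -> cont -> rtree n) F v :
  (forall p, runs (E p) (F p) v) -> runs (fun k => mix3 (E^~ k)) (mean3 F) v.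
Proof.
move=> H k; have [[c0 o0] [c1 o1] [c2 o2]] := And3 (H i0 k) (H i1 k) (H i2 k).
split=> [|b kb] /=; first by rewrite /mean3; lra.
by rewrite o0 ?o1 ?o2.
Qed.

Lemma runs_mix_others p (E : 'I_3 -> 'I_3 -> cont -> rtree n) F v :
  (forall q r, (q, r) = (next3 p, next3 (next3 p)) \/
               (q, r) = (next3 (next3 p), next3 p) -> runs (E q r) (F q r) v) ->
  runs (fun k => mix_others p (fun q r => E q r k)) (mean_others p F) v.
Proof.
move=> H k.
have [c0 o0] := H _ _ (or_introl erefl) k; have [c1 o1] := H _ _ (or_intror erefl) k.
split=> [|b kb] /=; first by rewrite /mean_others; lra.
by rewrite o0 ?o1.
Qed.

Definition leaf_path (Ep Eq Er : cont -> rtree n) (k : cont) :=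
  Ep (fun v => Eq (fun w => if w == v then k v else Er k)).

Definition known_leaf_path (Eq Er : cont -> rtree n) (b : bool) (k : cont) :=
  Eq (fun v => if v == b then k b else Er k).

(* [p, q, r] are the three children of a node in random order; [Ep] and [Eq]
   evaluate a random child of [p] and of [q], [Er] evaluates [r], and [Cp c]
   completes the evaluation of [p] given the value [c] found by [Ep]. *)
Definition complete_path (Eq Er : cont -> rtree n) (Cq : bool -> cont -> rtree n)
    (b : bool) (k : cont) :=
  Eq (fun c =>
    if c == b then Cq c (fun v => if v == b then k b else Er k)
    else Er (fun v => if v == b then k b else Cq c k)).

(** The order bets on the hints [c] and [c']: if they agree, [p] and [q] may settle the majority
    without [r]; otherwise [r] decides which hint to follow. *)
Definition evaluate_path (Ep Eq Er : cont -> rtree n)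
    (Cp Cq : bool -> cont -> rtree n) (k : cont) :=
  Ep (fun c => Eq (fun c' =>
    if c == c' then
      Cp c (fun v => if v == c then Cq c' (fun w => if w == v then k v else Er k)
                     else Er (fun w => if w == v then k v else Cq c' k))
    else
      Er (fun w => if c == w then Cp c (fun v => if v == w then k w else Cq c' k)
                   else Cq c' (fun v => if v == w then k w else Cp c k)))).

Lemma leaf_path_runs Ep Eq Er c vp vq vr :
  runs Ep c vp -> runs Eq c vq -> runs Er c vr ->
  runs (leaf_path Ep Eq Er) (c + c + if vq == vp then 0 else c) (maj vp vq vr).
Proof.
move=> Hp Hq Hr k; case: vp vq vr Hp Hq Hr => [] [] [] Hp Hq Hr /=;
  do ?[apply: (runs_bind Hp) => /= | apply: (runs_bind Hq) => /=
      | apply: (runs_bind Hr) => /=]; by split=> //; lra.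
Qed.

Lemma known_leaf_path_runs Eq Er c b vq vr : runs Eq c vq -> runs Er c vr ->
  runs (known_leaf_path Eq Er b) (c + if vq == b then 0 else c) (maj b vq vr).
Proof.
move=> Hq Hr k; case: b vq vr Hq Hr => [] [] [] Hq Hr /=;
  do ?[apply: (runs_bind Hq) => /= | apply: (runs_bind Hr) => /=];
  by split=> //; lra.
Qed.

(** [T1] and [T2] are the costs of evaluating a child and a grandchild. *)
Variables (T1 T2 M m : R).

(* [M] and [m] are the costs of completing a node of which a child of majority,
   respectively minority, value is known. *)
Definition complete_cost (v c : bool) : R := if c == v then M else m.

Definition complete_path_cost (b vq vr c : bool) : R :=
  T2 + if c == b then complete_cost vq c + (if vq == b then 0 else T1)
       else T1 + (if vr == b then 0 else complete_cost vq c).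

Definition evaluate_path_cost (vp vq vr c c' : bool) : R :=
  T2 + T2 +
  if c == c' then
    complete_cost vp c +
    (if vp == c then complete_cost vq c' + (if vq == vp then 0 else T1)
     else T1 + (if vr == vp then 0 else complete_cost vq c'))
  else
    T1 + (if c == vr then complete_cost vp c +
                          (if vp == vr then 0 else complete_cost vq c')
          else complete_cost vq c' + (if vq == vr then 0 else complete_cost vp c)).

Lemma complete_path_runs Eq Er Cq b vq vr c :
  runs Eq T2 c -> runs Er T1 vr -> runs (Cq c) (complete_cost vq c) vq ->
  runs (complete_path Eq Er Cq b) (complete_path_cost b vq vr c) (maj b vq vr).
Proof.
move=> Hq Hr HC k; case: b c vq vr Hq Hr HC => [] [] [] [] Hq Hr HC /=;
  do ?[apply: (runs_bind Hq) => /= | apply: (runs_bind Hr) => /=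
      | apply: (runs_bind HC) => /=];
  by split=> //; rewrite /complete_path_cost /complete_cost /=; lra.
Qed.

Lemma evaluate_path_runs Ep Eq Er Cp Cq vp vq vr c c' :
  runs Ep T2 c -> runs Eq T2 c' -> runs Er T1 vr ->
  runs (Cp c) (complete_cost vp c) vp -> runs (Cq c') (complete_cost vq c') vq ->
  runs (evaluate_path Ep Eq Er Cp Cq) (evaluate_path_cost vp vq vr c c')
       (maj vp vq vr).
Proof.
move=> Hp Hq Hr HP HQ k; rewrite /evaluate_path_cost.
case: c c' vp vq vr Hp Hq Hr HP HQ => [] [] [] [] [] Hp Hq Hr HP HQ /=;
  do ?[apply: (runs_bind Hp) => /= | apply: (runs_bind Hq) => /=
      | apply: (runs_bind Hr) => /= | apply: (runs_bind HP) => /=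
      | apply: (runs_bind HQ) => /=];
  by split=> //; rewrite /complete_cost /=; lra.
Qed.

Definition evaluate_step (E1 : 'I_3 -> cont -> rtree n)
    (E2 : 'I_3 -> 'I_3 -> cont -> rtree n)
    (C1 : 'I_3 -> 'I_3 -> bool -> cont -> rtree n) (k : cont) :=
  mix3 (fun p => mix_others p (fun q r => mix3 (fun z => mix3 (fun z' =>
    evaluate_path (E2 p z) (E2 q z') (E1 r) (C1 p z) (C1 q z') k)))).

Definition complete_step (E1 : 'I_3 -> cont -> rtree n)
    (E2 : 'I_3 -> 'I_3 -> cont -> rtree n)
    (C1 : 'I_3 -> 'I_3 -> bool -> cont -> rtree n) p b (k : cont) :=
  mix_others p (fun q r => mix3 (fun z =>
    complete_path (E2 q z) (E1 r) (C1 q z) b k)).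

Definition evaluate_leaves (E : 'I_3 -> cont -> rtree n) (k : cont) :=
  mix3 (fun p => mix_others p (fun q r => leaf_path (E p) (E q) (E r) k)).

Definition complete_leaves (E : 'I_3 -> cont -> rtree n) p b (k : cont) :=
  mix_others p (fun q r => known_leaf_path (E q) (E r) b k).

Section values.
Variable v : 'I_3 -> bool.
Let V := maj (v i0) (v i1) (v i2).

Lemma maj_others p q r : (q, r) = (next3 p, next3 (next3 p)) \/
  (q, r) = (next3 (next3 p), next3 p) -> maj (v p) (v q) (v r) = V.
Proof.
rewrite /V; move: p; apply: ord3P; rewrite ?(next3_0, next3_1, next3_2) => -[] [-> ->];
  by case: (v i0) (v i1) (v i2) => [] [] [].
Qed.

(** In the worst case one child dissents, and the first two disagree with probability 2/3. *)
Lemma evaluate_leaves_runs E c : 0 <= c -> (forall p, runs (E p) c (v p)) ->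
  runs (evaluate_leaves E) (8 / 3 * c) V.
Proof.
move=> c0 H; apply: runs_le.
  apply: runs_mix3 => p; apply: runs_mix_others => q r qr.
  rewrite -(maj_others qr); exact: (leaf_path_runs (H p) (H q) (H r)).
rewrite /mean3 /mean_others ?(next3_0, next3_1, next3_2).
by case: (v i0) (v i1) (v i2) => [] [] [] /=; lra.
Qed.

Lemma complete_leaves_runs E c p : 0 <= c -> (forall p, runs (E p) c (v p)) ->
  runs (complete_leaves E p (v p)) (if v p == V then 3 / 2 * c else 2 * c) V.
Proof.
move=> c0 H; apply: runs_le.
  apply: runs_mix_others => q r qr.
  rewrite -(maj_others qr); exact: (known_leaf_path_runs _ (H q) (H r)).
rewrite /V /mean_others; move: p; apply: ord3P; rewrite ?(next3_0, next3_1, next3_2);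
  by case: (v i0) (v i1) (v i2) => [] [] [] /=; lra.
Qed.

Variable g : 'I_3 -> 'I_3 -> bool.
Hypothesis vE : forall p, v p = maj (g p i0) (g p i1) (g p i2).

(* A random child of a node agrees with it with probability [w >= 2/3]. *)
Lemma mean3_child p : exists2 w : R, w = 2 / 3 \/ w = 1 &
  forall F : bool -> R, mean3 (fun z => F (g p z)) = w * F (v p) + (1 - w) * F (~~ v p).
Proof.
rewrite vE /mean3; case: (g p i0) (g p i1) (g p i2) => [] [] [];
  by [exists 1; [right|move=> F /=; lra]|exists (2 / 3); [left|move=> F /=; lra]].
Qed.

Variables (E1 : 'I_3 -> cont -> rtree n) (E2 : 'I_3 -> 'I_3 -> cont -> rtree n).
Variable C1 : 'I_3 -> 'I_3 -> bool -> cont -> rtree n.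
Hypothesis M_ge0 : 0 <= M.
Hypothesis le_Mm : M <= m.
Hypothesis le_MT : M <= T1.
Hypothesis E1_runs : forall p, runs (E1 p) T1 (v p).
Hypothesis E2_runs : forall p z, runs (E2 p z) T2 (g p z).
Hypothesis C1_runs : forall p z,
  runs (C1 p z (g p z)) (complete_cost (v p) (g p z)) (v p).

(** The bounds are the costs when every child has one dissenting grandchild and, in the majority
    case, the node has one dissenting child. *)
Lemma complete_step_runs p :
  runs (complete_step E1 E2 C1 p (v p))
    (if v p == V then T2 + 2 / 3 * T1 + (M + m) / 3
     else T2 + T1 + m / 3 + 2 / 3 * M) V.
Proof.
apply: runs_le.
  apply: runs_mix_others => q r qr; apply: runs_mix3 => z.
  rewrite -(maj_others qr); 
  exact: (complete_path_runs _ (E2_runs q z) (E1_runs r) (C1_runs q z)).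
rewrite /mean_others.
have [w0 w0E F0] := mean3_child i0; have [w1 w1E F1] := mean3_child i1.
have [w2 w2E F2] := mean3_child i2.
have meanE b q wq (Fq : forall F, mean3 (fun z => F (g q z)) =
    wq * F (v q) + (1 - wq) * F (~~ v q)) r :=
  Fq (complete_path_cost b (v q) (v r)).
move: p; apply: ord3P; rewrite ?(next3_0, next3_1, next3_2)
    ?(meanE _ _ _ F0) ?(meanE _ _ _ F1) ?(meanE _ _ _ F2)
    /V /complete_path_cost /complete_cost; clear F0 F1 F2 meanE;
  case: w0E => w0E; case: w1E => w1E; case: w2E => w2E; subst w0 w1 w2;
  move: M_ge0 le_Mm le_MT => M0 Mm MT;
  by case: (v i0) (v i1) (v i2) => [] [] [] /=; lra.
Qed.

(** The bound is the cost when the node and each of its children have one dissenting child. *)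
Lemma evaluate_step_runs :
  runs (evaluate_step E1 E2 C1)
    (23 / 27 * T1 + 2 * T2 + 26 / 27 * M + 2 / 3 * m) V.
Proof.
apply: runs_le.
  apply: runs_mix3 => p; apply: runs_mix_others => q r qr.
  apply: runs_mix3 => z; apply: runs_mix3 => z'.
  rewrite -(maj_others qr); 
  exact: (evaluate_path_runs (E2_runs p z) (E2_runs q z') (E1_runs r)
            (C1_runs p z) (C1_runs q z')).
have [w0 w0E F0] := mean3_child i0; have [w1 w1E F1] := mean3_child i1.
have [w2 w2E F2] := mean3_child i2.
(* The cost depends on [z] and [z'] only through the hints, so four weighted cases remain. *)
have meanE p q wp wq :
  (forall F, mean3 (fun z => F (g p z)) = wp * F (v p) + (1 - wp) * F (~~ v p)) ->
  (forall F, mean3 (fun z => F (g q z)) = wq * F (v q) + (1 - wq) * F (~~ v q)) ->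
  forall r, mean3 (fun z => mean3 (fun z' =>
      evaluate_path_cost (v p) (v q) (v r) (g p z) (g q z'))) =
  wp * (wq * evaluate_path_cost (v p) (v q) (v r) (v p) (v q) +
        (1 - wq) * evaluate_path_cost (v p) (v q) (v r) (v p) (~~ v q)) +
  (1 - wp) * (wq * evaluate_path_cost (v p) (v q) (v r) (~~ v p) (v q) +
        (1 - wq) * evaluate_path_cost (v p) (v q) (v r) (~~ v p) (~~ v q)).
  move=> Fp Fq r; rewrite -!Fq.
  exact: (Fp (fun c => mean3 (fun z' => evaluate_path_cost (v p) (v q) (v r) c (g q z')))).
rewrite [X in X <= _]/mean3 /mean_others ?(next3_0, next3_1, next3_2).
rewrite (meanE _ _ _ _ F0 F1) (meanE _ _ _ _ F0 F2) (meanE _ _ _ _ F1 F0)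
  (meanE _ _ _ _ F1 F2) (meanE _ _ _ _ F2 F0) (meanE _ _ _ _ F2 F1).
rewrite /evaluate_path_cost /complete_cost; clear F0 F1 F2 meanE.
case: w0E => w0E; case: w1E => w1E; case: w2E => w2E; subst w0 w1 w2;
  move: M_ge0 le_Mm le_MT => M0 Mm MT;
  by case: (v i0) (v i1) (v i2) => [] [] [] /=; lra.
Qed.

End values.
End strategies.

(** * The recursive algorithm and its cost recursion *)

Section algorithm.
Variable n : nat.
Local Notation cont := (bool -> rtree n).

(** The first argument places the leaves of a subtree among the [n] variables. *)
Definition evaluator h := ('I_(3 ^ h) -> 'I_n) -> cont -> rtree n.
Definition completer h := ('I_(3 ^ h) -> 'I_n) -> 'I_3 -> bool -> cont -> rtree n.

Definition evaluate0 : evaluator 0 :=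
  fun e k => RQuery (e ord0) (k false) (k true).

(* The evaluation of a node and its completion from the value of one child, at
   heights [h] and [h.+1]; the completion at height 0 is a dummy. *)
Fixpoint algorithm h :
    (evaluator h * completer h) * (evaluator h.+1 * completer h.+1) :=
  match h with
  | 0 => ((evaluate0, fun _ _ b k => k b),
          (fun e => evaluate_leaves (fun p => evaluate0 (e \o block_index p)),
           fun e => complete_leaves (fun p => evaluate0 (e \o block_index p))))
  | h'.+1 =>
      let: (a0, a1) := algorithm h' in
      (a1, (fun e => evaluate_step (fun p => a1.1 (e \o block_index p))
              (fun p z => a0.1 (e \o block_index p \o block_index z))
              (fun p => a1.2 (e \o block_index p)),
            fun e => complete_step (fun p => a1.1 (e \o block_index p))
              (fun p z => a0.1 (e \o block_index p \o block_index z))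
              (fun p => a1.2 (e \o block_index p))))
  end.

Variables (R : realType) (x : input n).

Definition value h (e : 'I_(3 ^ h) -> 'I_n) : bool := maj3 [ffun i => x (e i)].

Lemma value_block h (e : 'I_(3 ^ h.+1) -> 'I_n) :
  value e = maj (value (e \o block_index (inord 0)))
                (value (e \o block_index (inord 1)))
                (value (e \o block_index (inord 2))).
Proof.
rewrite /value [LHS]/=; congr maj; congr maj3; apply/ffunP => i;
  by rewrite !ffunE.
Qed.

Definition evaluates h (E : evaluator h) (T : R) : Prop :=
  forall e, runs x (E e) T (value e).

Definition completes h (C : completer h.+1) (M m : R) : Prop :=
  forall e p, let v := value (e \o block_index p) in
  runs x (C e p v) (if v == value e then M else m) (value e).

Definition bounds h (T0 T1 M m : R) : Prop :=
  [/\ evaluates (algorithm h).1.1 T0, evaluates (algorithm h).2.1 T1 &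
      completes (algorithm h).2.2 M m].

Lemma bounds_le h T0 T1 M m T0' T1' M' m' : bounds h T0 T1 M m ->
  T0 <= T0' -> T1 <= T1' -> M <= M' -> m <= m' -> bounds h T0' T1' M' m'.
Proof.
move=> [H0 H1 HC] l0 l1 lM lm; split=> [e|e|e p] /=.
- exact: runs_le l0.
- exact: runs_le l1.
- by apply: runs_le (HC e p) _; case: ifP.
Qed.

Lemma bounds0 : bounds 0 1 (8 / 3) (3 / 2) 2.
Proof.
have H0 : evaluates evaluate0 1.
  move=> e k /=; rewrite /value /= ffunE.
  by case: (x (e ord0)); split.
have T1 : 0 <= 1 :> R by exact: ler01.
split=> //= e.
  rewrite value_block.
  have := evaluate_leaves_runs (v := fun p => value (e \o block_index p)) T1
            (fun p => H0 (e \o block_index p)).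
  by rewrite mulr1.
move=> p; rewrite value_block.
have := complete_leaves_runs (v := fun p => value (e \o block_index p)) p T1
          (fun p => H0 (e \o block_index p)).
by rewrite !mulr1.
Qed.

Lemma bounds_step h T0 T1 M m : bounds h T0 T1 M m ->
  0 <= M -> M <= m -> M <= T1 ->
  bounds h.+1 T1 (23 / 27 * T1 + 2 * T0 + 26 / 27 * M + 2 / 3 * m)
    (T0 + 2 / 3 * T1 + (M + m) / 3) (T0 + T1 + m / 3 + 2 / 3 * M).
Proof.
rewrite /bounds /=; case: (algorithm h) => [[E0 C0] [E1 C1]] /= [H0 H1 HC] M0 Mm MT.
split=> //= e.
  rewrite value_block; apply: (evaluate_step_runs
    (v := fun p => value (e \o block_index p))
    (g := fun p z => value (e \o block_index p \o block_index z))) => // *;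
    by [exact: value_block|exact: H1|exact: H0|exact: HC].
move=> p /=; rewrite (value_block e).
apply: (complete_step_runs (v := fun p => value (e \o block_index p))
  (g := fun p z => value (e \o block_index p \o block_index z))) => // *;
  by [exact: value_block|exact: H1|exact: H0|exact: HC].
Qed.

Definition rate : R := 2 + 649 / 10 ^+ 3 + 44 / 10 ^+ 5.

(* [(1, M, m)] solves, up to rounding, the eigenvector equations of the
   recursion in [bounds_step] for the eigenvalue [rate]. *)
Lemma bounds_geometric h (c := 1 + 55 / 10 ^+ 4 : R)
    (M := 559 / 10 ^+ 3 + 575 / 10 ^+ 6) (m := 755 / 10 ^+ 3 + 790 / 10 ^+ 6) :
  bounds h.+2 (c * rate ^+ h.+2) (c * rate ^+ h.+3)
    (c * M * rate ^+ h.+3) (c * m * rate ^+ h.+3).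
Proof.
have rate_gt0 : 0 < rate by rewrite /rate; lra.
elim: h => [|h IH].
  (* Two steps from [bounds0] give explicit costs at heights 2 and 3. *)
  have B1 := bounds_step bounds0 _ _ _; have {B1} := bounds_step (B1 _ _ _) _ _ _.
  move=> B2; apply: (bounds_le (B2 _ _ _ _ _ _)); rewrite /c /M /m /rate ?exprS ?expr0; lra.
have y0 : 0 <= rate ^+ h.+2 by rewrite exprn_ge0 // ltW.
move: IH y0; rewrite !(exprS _ h.+3) !(exprS _ h.+2).
set y := rate ^+ h.+2 => IH y0.
apply: (bounds_le (bounds_step IH _ _ _)); rewrite /c /M /m /rate; lra.
Qed.

(** Height 1 calls for the constant 1.007: its cost 8/3 exceeds 1.0055 times [rate]. *)
Lemma evaluates_algorithm h : evaluates (algorithm h).1.1 ((1 + 7 / 10 ^+ 3) * rate ^+ h).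
Proof.
have le e T T' : runs x ((algorithm h).1.1 e) T (value e) -> T <= T' ->
  runs x ((algorithm h).1.1 e) T' (value e) by exact: runs_le.
case: h le => [|[|h]] le e.
- by have [H _ _] := bounds0; apply: le (H e) _; rewrite expr0; lra.
- by have [_ H _] := bounds0; apply: le (H e) _; rewrite expr1 /rate; lra.
have [H _ _] := bounds_geometric h; apply: le (H e) _.
by rewrite ler_wpM2r ?exprn_ge0 // /rate; lra.
Qed.

End algorithm.

(* 2.57143 = 2 + 571 / 10^3 + 43 / 10^5, 2.64944 = 2 + 649 / 10^3 + 44 / 10^5
   and 1.007 = 1 + 7 / 10^3, written with small numerals because those of
   [ring_scope] are unary. *)
Theorem theorem1 (R : realType) (h : nat) (delta : R)
  (delta_ge0 : 0 <= delta) (delta_le_half : delta <= 1 / 2) :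
  (((1 / 2 - delta) * (2 + 571 / 10 ^+ 3 + 43 / 10 ^+ 5) ^+ h)%:E
     <= rand_complexity delta (@maj3 h)
     <= ((1 + 7 / 10 ^+ 3) * (2 + 649 / 10 ^+ 3 + 44 / 10 ^+ 5) ^+ h)%:E)%E.
Proof.
apply/andP; split.
  have [K [Hd hardK] leK] := hard_bound R h.
  apply: le_ereal_inf_tmp => _ [A err <-].
  have K0 : 0 <= K.
    have b0 : 0 <= 2 + 571 / 10 ^+ 3 + 43 / 10 ^+ 5 :> R by lra.
    by have := le_trans (exprn_ge0 h b0) leK; lra.
  apply: le_trans (yao hardK K0 err); rewrite lee_fin.
  apply: (@le_trans _ _ ((1 / 2 - delta) * (2 * K))); last lra.
  by rewrite ler_wpM2l //; lra.
(* The final continuation outputs the computed value; with error 0 the tree is admissible for every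
   [delta] in the range. *)
pose t := (algorithm (3 ^ h) h).1.1 id (fun b => RLeaf b).
have t_runs x : expected_cost R t x <= (1 + 7 / 10 ^+ 3) * rate R ^+ h /\
    outputs t x (@maj3 h x).
  have -> : @maj3 h x = value x id by congr maj3; apply/ffunP => i; rewrite ffunE.
  have [c o] := @evaluates_algorithm _ R x h id (fun b => RLeaf b); split.
    by apply: le_trans c _; rewrite /= addr0.
  by apply: o => /=.
apply: (@le_trans _ _ (\big[maxe/-oo%E]_x rcost (law R t) x)).
  apply: ereal_inf_lbound; exists (law R t) => // x.
  by rewrite rerror_law ?lee_fin //; have [] := t_runs x.
apply/bigmax_leP; split=> [|x _]; first exact: leNye.
by apply: le_trans (rcost_law _ _ _) _; rewrite lee_fin; have [] := t_runs x.
Qed.
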